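(* Let $\mathcal{C}$ be a pivotal finite tensor category with pivotal structure $\mathfrak{p}$, let $\mathcal{M}$ be an exact left $\mathcal{C}$-module category with relative Serre functor $(\mathbb{S},\phi)$, and let $M$ be an object of $\mathcal{M}$. If $\mathcal{M}$ admits a pivotal structure $\widetilde{\mathfrak{p}}:\mathrm{id}_{\mathcal M}\to\mathbb S$ (respecting $\mathfrak p$), then the algebra $\underline{\mathrm{End}}(M)=[M,M]$ in $\mathcal{C}$ is a symmetric Frobenius algebra with Frobenius form $$t_M:=\Big([M,M]\xrightarrow{\ [M,\widetilde{\mathfrak{p}}_M]\ }[M,\mathbb{S}(M)]\xrightarrow{\ \underline{\mathrm{tr}}_M\ }1\Big).$$
   Context: Let $k$ be a field. A finite abelian category is a $k$-linear category equivalent to the category of finite-dimensional left modules over a finite-dimensional $k$-algebra. A finite tensor category is a finite abelian category with a rigid monoidal structure whose tensor product is $k$-bilinear and whose unit object $1$ is simple. Monoidal and module categories are assumed strict. Left duals are $(X^*,\mathrm{ev}_X:X^*\otimes X\to 1,\mathrm{coev}_X:1\to X\otimes X^* )$, right duals are ${}^*X$ with $\mathrm{ev}'_X:X\otimes{}^*X\to 1$; they are chosen so that $(X\otimes Y)^*=Y^*\otimes X^*$, $1^*=1$ and $(-)^*$, ${}^*(-)$ are mutually inverse. A pivotal structure of $\mathcal C$ is an isomorphism $\mathfrak p:\mathrm{id}_{\mathcal C}\to(-)^{**}$ of tensor functors. A finite left $\mathcal{C}$-module category is a finite abelian category $\mathcal{M}$ with an action $\triangleright$ of $\mathcal{C}$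 that is $k$-bilinear and right exact in each variable; it is exact if $P\triangleright M$ is projective for all projective $P\in\mathcal{C}$ and all $M\in\mathcal{M}$. Internal Hom: $[M,-]$ (written $\underline{\mathrm{Hom}}(M,-)$ in the literature) is a right adjoint of $\mathcal{C}\to\mathcal{M}$, $X\mapsto X\triangleright M$, with unit $\underline{\mathrm{coev}}_{X,M}:X\to[M,X\triangleright M]$ and counit $\underline{\mathrm{ev}}_{M,N}:[M,N]\triangleright M\to N$; it is a functor $\mathcal M^{\mathrm{op}}\times\mathcal M\to\mathcal C$. The composition $\underline{\mathrm{comp}}_{M_1,M_2,M_3}:[M_2,M_3]\otimes[M_1,M_2]\to[M_1,M_3]$ corresponds under the adjunction to $\underline{\mathrm{ev}}_{M_2,M_3}\circ(\mathrm{id}\triangleright\underline{\mathrm{ev}}_{M_1,M_2})$. $[M,M]$ is an algebra in $\mathcal{C}$ with multiplication $\underline{\mathrm{comp}}_{M,M,M}$ and unit $\underline{\mathrm{coev}}_{1,M}$. The isomorphism $\mathfrak{a}_{X,M,N}:X\otimes[M,N]\to[M,X\triangleright N]$ corresponds to $X\triangleright\underline{\mathrm{ev}}_{M,N}$, and the isomorphism $\mathfrak{b}_{M,N,X}:[M,N]\otimes X\to[{}^*X\triangleright M,N]$ corresponds to $\underline{\mathrm{ev}}_{M,N}\circ(\mathrm{id}\triangleright\mathrm{ev}'_X\triangleright\mathrm{id}_M)$. A relative Serre functor of $\mathcal{M}$ is a pair $(\mathbb{S},\phi)$ of a functor $\mathbb{S}:\mathcal M\to\mathcal M$ and a natural isomorphism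 $\phi_{M,N}:[N,\mathbb{S}(M)]\to[M,N]^*$ compatible with the right $\mathcal{C}$-module structures, i.e. $\phi_{M,{}^*Y\triangleright N}\circ\mathfrak b_{N,\mathbb S(M),Y}=(\mathfrak a_{{}^*Y,M,N}^{-1})^*\circ(\phi_{M,N}\otimes\mathrm{id}_Y)$ (using $[M,N]^*\otimes Y=({}^*Y\otimes[M,N])^*$). There is then a unique natural isomorphism $\xi_{X,M}:X^{**}\triangleright\mathbb{S}(M)\to\mathbb{S}(X\triangleright M)$ (the twisted $\mathcal{C}$-module structure of $\mathbb S$) such that $\phi_{X\triangleright M,N}\circ[N,\xi_{X,M}]\circ\mathfrak{a}_{X^{**},N,\mathbb{S}(M)}=(\mathfrak{b}_{M,N,X^*}^{-1})^*\circ(\mathrm{id}_{X^{**}}\otimes\phi_{M,N})$ (using $X^{**}\otimes[M,N]^*=([M,N]\otimes X^* )^*$). The trace is $\underline{\mathrm{tr}}_M:=\underline{\mathrm{coev}}_{1,M}^*\circ\phi_{M,M}:[M,\mathbb{S}(M)]\to 1$. A pivotal structure of $\mathcal{M}$ respecting $\mathfrak p$ is a natural isomorphism $\widetilde{\mathfrak p}:\mathrm{id}_{\mathcal M}\to\mathbb S$ with $\widetilde{\mathfrak p}_{X\triangleright M}=\xi_{X,M}\circ(\mathfrak p_X\triangleright\widetilde{\mathfrak p}_M)$ for all $X\in\mathcal C$, $M\in\mathcal M$. A Frobenius algebra in $\mathcal{C}$ is a pair $(A,\lambda)$ of an algebra $A$ in $\mathcal C$ with multiplication $\mu$ and a morphism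 $\lambda:A\to1$ (the Frobenius form) such that $\psi:=(\lambda\mu\otimes\mathrm{id}_{A^*})\circ(\mathrm{id}_A\otimes\mathrm{coev}_A):A\to A^*$ is invertible. Its Nakayama automorphism is $\nu_A:=\psi^{-1}\circ\psi^*\circ\mathfrak p_A$, and it is symmetric if $\nu_A=\mathrm{id}_A$. *)

(* Defs.v *)
From HB Require Import structures.
From mathcomp Require Import all_boot all_algebra.
From mathcomp Require Import boolp classical_sets.

Set Implicit Arguments.
Unset Strict Implicit.
Unset Printing Implicit Defensive.

Import GRing.Theory.
Local Open Scope ring_scope.

Declare Scope cat_scope.
Delimit Scope cat_scope with cat.

Reserved Notation "g ∘ f" (at level 50, left associativity).
Reserved Notation "X ⊗ Y" (at level 40, left associativity).
Reserved Notation "f ⊗h g" (at level 40, left associativity).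
Reserved Notation "X ▷ M" (at level 41, right associativity).
Reserved Notation "f ▷h g" (at level 41, right associativity).

Record lincat (k : fieldType) := LinCat {
  ob :> Type;
  mor : ob -> ob -> lmodType k;
  idm : forall X, mor X X;
  compm : forall X Y Z, mor Y Z -> mor X Y -> mor X Z;
  comp1m : forall X Y (f : mor X Y), compm (idm Y) f = f;
  compm1 : forall X Y (f : mor X Y), compm f (idm X) = f;
  compA : forall X Y Z W (h : mor Z W) (g : mor Y Z) (f : mor X Y),
    compm h (compm g f) = compm (compm h g) f;
  comp_linearl : forall X Y Z (f : mor X Y), linear (fun g : mor Y Z => compm g f);
  comp_linearr : forall X Y Z (g : mor Y Z), linear (fun f : mor X Y => compm g f)
}.
Arguments mor {k l} X Y.
Arguments idm {k l} X.
Arguments compm {k l X Y Z} g f.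
Notation "g ∘ f" := (compm g f) : cat_scope.
Local Open Scope cat_scope.

Section Category.
Context {k : fieldType} {C : lincat k}.

(* The identity, seen as a morphism between objects that are equal.  By proof
   irrelevance it only depends on the two objects; it plays the role of the
   (invisible) coherence isomorphisms of a strict structure. *)
Definition eqm {X Y : C} (e : X = Y) : mor X Y :=
  match e in _ = Z return mor X Z with erefl => idm X end.

Definition are_inverse {X Y : C} (f : mor X Y) (g : mor Y X) : Prop :=
  g ∘ f = idm X /\ f ∘ g = idm Y.

Definition is_iso {X Y : C} (f : mor X Y) : Prop := exists g, are_inverse f g.

(* Total inverse: the inverse of f if f is invertible, and 0 otherwise. *)
Definition invm {X Y : C} (f : mor X Y) : mor Y X :=
  xget 0 [set g | are_inverse f g].

Definition is_mono {X Y : C} (f : mor X Y) : Prop :=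
  forall Z (g h : mor Z X), f ∘ g = f ∘ h -> g = h.

Definition is_epi {X Y : C} (f : mor X Y) : Prop :=
  forall Z (g h : mor Y Z), g ∘ f = h ∘ f -> g = h.

Definition projective (P : C) : Prop :=
  forall X Y (q : mor X Y), is_epi q ->
  forall f : mor P Y, exists g : mor P X, q ∘ g = f.

Definition simple_ob (X : C) : Prop :=
  idm X <> 0 /\ forall Y (m : mor Y X), is_mono m -> m = 0 \/ is_iso m.

Definition is_coker {X Y Z : C} (f : mor X Y) (q : mor Y Z) : Prop :=
  q ∘ f = 0 /\
  forall W (h : mor Y W), h ∘ f = 0 -> exists! u : mor Z W, u ∘ q = h.

End Category.

Record functor {k : fieldType} (C D : lincat k) := Functor {
  fob :> C -> D;
  fmap : forall X Y : C, mor X Y -> mor (fob X) (fob Y);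
  fmap_id : forall X, fmap (idm X) = idm (fob X);
  fmap_comp : forall X Y Z (g : mor Y Z) (f : mor X Y),
    fmap (g ∘ f) = fmap g ∘ fmap f
}.
Arguments fmap {k C D} f {X Y} _ : rename.

Definition functor_id {k : fieldType} (C : lincat k) : functor C C :=
  @Functor k C C (fun X => X) (fun X Y f => f) (fun=> erefl) (fun _ _ _ _ _ => erefl).

Section Functors.
Context {k : fieldType}.
Implicit Types C D E : lincat k.

Program Definition functor_comp C D E (G : functor D E) (F : functor C D) :
  functor C E := @Functor k C E (fun X => G (F X)) (fun X Y f => fmap G (fmap F f)) _ _.
Next Obligation. by rewrite !fmap_id. Qed.
Next Obligation. by rewrite !fmap_comp. Qed.

Definition linear_functor C D (F : functor C D) : Prop :=
  forall X Y : C, linear (fun f : mor X Y => fmap F f).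

Definition natural_iso C D (F G : functor C D)
    (t : forall X, mor (F X) (G X)) : Prop :=
  (forall X Y (f : mor X Y), fmap G f ∘ t X = t Y ∘ fmap F f) /\
  (forall X, is_iso (t X)).

Definition linear_equivalent C D : Prop :=
  exists (F : functor C D) (G : functor D C),
  [/\ linear_functor F, linear_functor G,
      exists t, natural_iso (F := functor_comp G F) (G := functor_id C) t
    & exists t, natural_iso (F := functor_comp F G) (G := functor_id D) t].

(* For functors that are additive, which is the only use made of it. *)
Definition right_exact C D (F : functor C D) : Prop :=
  forall X Y Z (f : mor X Y) (q : mor Y Z),
  is_coker f q -> is_coker (fmap F f) (fmap F q).

End Functors.

(* Unlike [falgType], this includes the zero algebra, whose category of modules
   is the zero category. *)
Record fdalg (k : fieldType) := FdAlg {
  fdalg_sort :> vectType k;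
  amul : fdalg_sort -> fdalg_sort -> fdalg_sort;
  aone : fdalg_sort;
  amulA : associative amul;
  amul1a : left_id aone amul;
  amula1 : right_id aone amul;
  amul_linearl : forall b, linear (fun a => amul a b);
  amul_linearr : forall a, linear (fun b => amul a b)
}.
Arguments aone {k} f.

Record fdmod {k : fieldType} (A : fdalg k) := FdMod {
  fdmod_sort :> vectType k;
  aact : A -> fdmod_sort -> fdmod_sort;
  aact1 : forall v, aact (aone A) v = v;
  aactM : forall a b v, aact (amul a b) v = aact a (aact b v);
  aact_linearl : forall v, linear (fun a => aact a v);
  aact_linearr : forall a, linear (fun v => aact a v)
}.

Section ModuleCategory.
Context {k : fieldType} (A : fdalg k).

Section Hom.
Variables V W : fdmod A.

Definition equivariant : {pred 'Hom(V, W)} :=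
  fun f => `[< forall a v, f (aact a v) = aact a (f v) >].

Lemma equivariant_submod : submod_closed equivariant.
Proof.
split.
  apply/asboolP => a v; rewrite !lfunE /=.
  have := @aact_linearr _ _ W a (-1) 0 0.
  by rewrite scaler0 addr0 scaleN1r addNr => ->.
move=> c f g /asboolP hf /asboolP hg; apply/asboolP => a v.
by rewrite !add_lfunE !scale_lfunE hf hg aact_linearr.
Qed.

HB.instance Definition _ :=
  GRing.isSubmodClosed.Build k 'Hom(V, W) equivariant equivariant_submod.

Record modhom := ModHom { modhom_val : 'Hom(V, W); _ : modhom_val \in equivariant }.

HB.instance Definition _ := [isSub of modhom for modhom_val].
HB.instance Definition _ := [Choice of modhom by <:].
HB.instance Definition _ := [SubChoice_isSubZmodule of modhom by <:].
HB.instance Definition _ := [SubZmodule_isSubLmodule of modhom by <:].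

Lemma modhomE (f : modhom) a v :
  modhom_val f (aact a v) = aact a (modhom_val f v).
Proof. by case: f => f /= /asboolP. Qed.

End Hom.

Lemma modhom_id_subproof (V : fdmod A) : (\1%VF : 'Hom(V, V)) \in @equivariant V V.
Proof. by apply/asboolP => a v; rewrite !id_lfunE. Qed.

Lemma modhom_comp_subproof (U V W : fdmod A) (g : modhom V W) (f : modhom U V) :
  (modhom_val g \o modhom_val f)%VF \in @equivariant U W.
Proof. by apply/asboolP => a v; rewrite !comp_lfunE !modhomE. Qed.

Program Definition fdmod_cat : lincat k :=
  @LinCat k (fdmod A) (fun V W => modhom V W)
    (fun V => ModHom (modhom_id_subproof V))
    (fun U V W g f => ModHom (modhom_comp_subproof g f)) _ _ _ _ _.
Next Obligation. by apply: val_inj; rewrite /= comp_lfun1l. Qed.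
Next Obligation. by apply: val_inj; rewrite /= comp_lfun1r. Qed.
Next Obligation. by apply: val_inj; rewrite /= comp_lfunA. Qed.
Next Obligation.
by move=> c h1 h2; apply: val_inj; rewrite /= comp_lfunDl comp_lfunZl.
Qed.
Next Obligation.
by move=> c h1 h2; apply: val_inj; rewrite /= comp_lfunDr comp_lfunZr.
Qed.

End ModuleCategory.

Definition finite_abelian {k : fieldType} (C : lincat k) : Prop :=
  exists A : fdalg k, linear_equivalent C (fdmod_cat A).

(* Strict monoidal: associativity and unitality are equalities of objects and of
   morphisms.  The pentagon and triangle axioms hold by proof irrelevance. *)
Record moncat (k : fieldType) := MonCat {
  moncat_sort :> lincat k;
  tens : moncat_sort -> moncat_sort -> moncat_sort;
  unit1 : moncat_sort;
  tensm : forall X X' Y Y' : moncat_sort,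
    mor X X' -> mor Y Y' -> mor (tens X Y) (tens X' Y');
  tensm_id : forall X Y, tensm (idm X) (idm Y) = idm (tens X Y);
  tensm_comp : forall X X' X'' Y Y' Y''
    (f' : mor X' X'') (f : mor X X') (g' : mor Y' Y'') (g : mor Y Y'),
    tensm (f' ∘ f) (g' ∘ g) = tensm f' g' ∘ tensm f g;
  tensA : forall X Y Z, tens X (tens Y Z) = tens (tens X Y) Z;
  tens1X : forall X, tens unit1 X = X;
  tensX1 : forall X, tens X unit1 = X;
  tensmA : forall X X' Y Y' Z Z' (f : mor X X') (g : mor Y Y') (h : mor Z Z'),
    eqm (tensA X' Y' Z') ∘ tensm f (tensm g h) =
    tensm (tensm f g) h ∘ eqm (tensA X Y Z);
  tensm1f : forall X X' (f : mor X X'),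
    eqm (tens1X X') ∘ tensm (idm unit1) f = f ∘ eqm (tens1X X);
  tensmf1 : forall X X' (f : mor X X'),
    eqm (tensX1 X') ∘ tensm f (idm unit1) = f ∘ eqm (tensX1 X)
}.
Arguments unit1 {k m}.
Arguments tensm {k m X X' Y Y'} f g.
Notation "X ⊗ Y" := (tens X Y) : cat_scope.
Notation "f ⊗h g" := (tensm f g) : cat_scope.
Notation "𝟙" := unit1 : cat_scope.

(* [ld X] is the left dual X^* and [rd X] the right dual ^*X.  The equalities
   (X ⊗ Y)^* = Y^* ⊗ X^*, 1^* = 1 and (^*X)^* = X = ^*(X^* ) are the canonical
   identifications, i.e. they match the evaluation morphisms (the coevaluations
   then match too, being determined by the evaluations). *)
Record rigcat (k : fieldType) := RigCat {
  rigcat_sort :> moncat k;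
  ld : rigcat_sort -> rigcat_sort;
  ev : forall X, mor (ld X ⊗ X) 𝟙;
  coev : forall X, mor 𝟙 (X ⊗ ld X);
  ld_zigzag : forall X,
    eqm (tensX1 X) ∘ (idm X ⊗h ev X) ∘ eqm (esym (tensA X (ld X) X)) ∘
      (coev X ⊗h idm X) ∘ eqm (esym (tens1X X)) = idm X;
  ld_zagzig : forall X,
    eqm (tens1X (ld X)) ∘ (ev X ⊗h idm (ld X)) ∘ eqm (tensA (ld X) X (ld X)) ∘
      (idm (ld X) ⊗h coev X) ∘ eqm (esym (tensX1 (ld X))) = idm (ld X);
  rd : rigcat_sort -> rigcat_sort;
  rev : forall X, mor (X ⊗ rd X) 𝟙;
  rcoev : forall X, mor 𝟙 (rd X ⊗ X);
  rd_zigzag : forall X,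
    eqm (tens1X X) ∘ (rev X ⊗h idm X) ∘ eqm (tensA X (rd X) X) ∘
      (idm X ⊗h rcoev X) ∘ eqm (esym (tensX1 X)) = idm X;
  rd_zagzig : forall X,
    eqm (tensX1 (rd X)) ∘ (idm (rd X) ⊗h rev X) ∘
      eqm (esym (tensA (rd X) X (rd X))) ∘
      (rcoev X ⊗h idm (rd X)) ∘ eqm (esym (tens1X (rd X))) = idm (rd X);
  ld_tens : forall X Y, ld (X ⊗ Y) = ld Y ⊗ ld X;
  ld_unit : ld 𝟙 = 𝟙;
  ld_rd : forall X, ld (rd X) = X;
  rd_ld : forall X, rd (ld X) = X;
  ev_tens : forall X Y,
    ev (X ⊗ Y) =
    ev Y ∘ (idm (ld Y) ⊗h (eqm (tens1X Y) ∘ (ev X ⊗h idm Y))) ∘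
      (idm (ld Y) ⊗h eqm (tensA (ld X) X Y)) ∘
      eqm (esym (tensA (ld Y) (ld X) (X ⊗ Y))) ∘
      (eqm (ld_tens X Y) ⊗h idm (X ⊗ Y));
  ev_unit : ev 𝟙 = eqm (tensX1 𝟙) ∘ (eqm ld_unit ⊗h idm 𝟙);
  rev_ev : forall X, rev X = ev (rd X) ∘ (eqm (esym (ld_rd X)) ⊗h idm (rd X))
}.

Arguments ld_unit {k r}.

Record fintenscat (k : fieldType) := FinTensCat {
  fintenscat_sort :> rigcat k;
  fintens_finite : finite_abelian fintenscat_sort;
  tensm_linearl : forall (X X' Y Y' : fintenscat_sort) (g : mor Y Y'),
    linear (fun f : mor X X' => f ⊗h g);
  tensm_linearr : forall (X X' Y Y' : fintenscat_sort) (f : mor X X'),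
    linear (fun g : mor Y Y' => f ⊗h g);
  unit1_simple : simple_ob (𝟙 : fintenscat_sort)
}.

Section Duality.
Context {k : fieldType} {C : rigcat k}.
Implicit Types X Y Z : C.

Definition ldm {X Y} (f : mor X Y) : mor (ld Y) (ld X) :=
  eqm (tens1X (ld X)) ∘ (ev Y ⊗h idm (ld X)) ∘ eqm (tensA (ld Y) Y (ld X)) ∘
    (idm (ld Y) ⊗h (f ⊗h idm (ld X))) ∘ (idm (ld Y) ⊗h coev X) ∘
    eqm (esym (tensX1 (ld Y))).

Lemma ldd_tens X Y : ld (ld (X ⊗ Y)) = ld (ld X) ⊗ ld (ld Y).
Proof. by rewrite !ld_tens. Qed.

Lemma ldd_unit : ld (ld 𝟙) = 𝟙 :> C.
Proof. by rewrite !ld_unit. Qed.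

Lemma ld_tens_rd X Y : ld X ⊗ Y = ld (rd Y ⊗ X).
Proof. by rewrite ld_tens ld_rd. Qed.

Lemma ld_tens_ld X Y : ld (ld X) ⊗ ld Y = ld (Y ⊗ ld X).
Proof. by rewrite ld_tens. Qed.

End Duality.

Record pivotal {k : fieldType} (C : rigcat k) := Pivotal {
  piv :> forall X : C, mor X (ld (ld X));
  piv_iso : forall X, is_iso (piv X);
  piv_nat : forall X Y (f : mor X Y), piv Y ∘ f = ldm (ldm f) ∘ piv X;
  piv_tens : forall X Y, eqm (ldd_tens X Y) ∘ piv (X ⊗ Y) = piv X ⊗h piv Y;
  piv_unit : eqm ldd_unit ∘ piv 𝟙 = idm 𝟙
}.

Section Algebras.
Context {k : fieldType} {C : rigcat k}.
Variables (A : C) (mu : mor (A ⊗ A) A) (eta : mor 𝟙 A).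

Definition is_algebra : Prop :=
  [/\ mu ∘ (mu ⊗h idm A) ∘ eqm (tensA A A A) = mu ∘ (idm A ⊗h mu),
      mu ∘ (eta ⊗h idm A) ∘ eqm (esym (tens1X A)) = idm A
    & mu ∘ (idm A ⊗h eta) ∘ eqm (esym (tensX1 A)) = idm A].

Variable lam : mor A 𝟙.

Definition frobenius_map : mor A (ld A) :=
  eqm (tens1X (ld A)) ∘ ((lam ∘ mu) ⊗h idm (ld A)) ∘ eqm (tensA A A (ld A)) ∘
    (idm A ⊗h coev A) ∘ eqm (esym (tensX1 A)).

Definition is_frobenius_algebra : Prop := is_algebra /\ is_iso frobenius_map.

Definition nakayama (p : pivotal C) : mor A A :=
  invm frobenius_map ∘ ldm frobenius_map ∘ p A.

Definition is_symmetric_frobenius_algebra (p : pivotal C) : Prop :=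
  is_frobenius_algebra /\ nakayama p = idm A.

End Algebras.

Record modcat {k : fieldType} (C : moncat k) := ModCat {
  modcat_sort :> lincat k;
  mact : C -> modcat_sort -> modcat_sort;
  mactm : forall (X X' : C) (M M' : modcat_sort),
    mor X X' -> mor M M' -> mor (mact X M) (mact X' M');
  mactm_id : forall X M, mactm (idm X) (idm M) = idm (mact X M);
  mactm_comp : forall X X' X'' M M' M''
    (f' : mor X' X'') (f : mor X X') (g' : mor M' M'') (g : mor M M'),
    mactm (f' ∘ f) (g' ∘ g) = mactm f' g' ∘ mactm f g;
  mactA : forall X Y M, mact X (mact Y M) = mact (X ⊗ Y) M;
  mact1 : forall M, mact 𝟙 M = M;
  mactmA : forall X X' Y Y' M M' (f : mor X X') (g : mor Y Y') (h : mor M M'),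
    eqm (mactA X' Y' M') ∘ mactm f (mactm g h) =
    mactm (f ⊗h g) h ∘ eqm (mactA X Y M);
  mactm1 : forall M M' (h : mor M M'),
    eqm (mact1 M') ∘ mactm (idm 𝟙) h = h ∘ eqm (mact1 M)
}.
Arguments mactm {k C m X X' M M'} f g.
Notation "X ▷ M" := (mact X M) : cat_scope.
Notation "f ▷h g" := (mactm f g) : cat_scope.

Section ActionFunctors.
Context {k : fieldType} {C : moncat k} (MM : modcat C).

Program Definition act_on (M : MM) : functor C MM :=
  @Functor k C MM (fun X => X ▷ M) (fun X Y f => f ▷h idm M) _ _.
Next Obligation. by rewrite mactm_id. Qed.
Next Obligation. by rewrite -mactm_comp comp1m. Qed.

Program Definition act_by (X : C) : functor MM MM :=
  @Functor k MM MM (fun M => X ▷ M) (fun M N g => idm X ▷h g) _ _.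
Next Obligation. by rewrite mactm_id. Qed.
Next Obligation. by rewrite -mactm_comp comp1m. Qed.

End ActionFunctors.

Record finmodcat {k : fieldType} (C : fintenscat k) := FinModCat {
  finmodcat_sort :> modcat C;
  finmod_finite : finite_abelian finmodcat_sort;
  mactm_linearl : forall (X X' : C) (M M' : finmodcat_sort) (g : mor M M'),
    linear (fun f : mor X X' => f ▷h g);
  mactm_linearr : forall (X X' : C) (M M' : finmodcat_sort) (f : mor X X'),
    linear (fun g : mor M M' => f ▷h g);
  act_on_right_exact : forall M, right_exact (act_on (MM := finmodcat_sort) M);
  act_by_right_exact : forall X, right_exact (act_by finmodcat_sort X)
}.

Definition exact_modcat {k : fieldType} {C : fintenscat k} (MM : finmodcat C) : Prop :=
  forall P : C, projective P -> forall M : MM, projective (P ▷ M).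

(* For each M, a functor [M, -] right adjoint to X |-> X ▷ M. *)
Record inthom {k : fieldType} {C : moncat k} (MM : modcat C) := IntHom {
  ihomF :> MM -> functor MM C;
  icoev : forall (X : C) (M : MM), mor X (ihomF M (X ▷ M));
  iev : forall M N : MM, mor (ihomF M N ▷ M) N;
  icoev_nat : forall (X Y : C) (M : MM) (f : mor X Y),
    icoev Y M ∘ f = fmap (ihomF M) (f ▷h idm M) ∘ icoev X M;
  iev_nat : forall (M N N' : MM) (g : mor N N'),
    iev M N' ∘ (fmap (ihomF M) g ▷h idm M) = g ∘ iev M N;
  iev_icoev : forall (X : C) (M : MM),
    iev M (X ▷ M) ∘ (icoev X M ▷h idm M) = idm (X ▷ M);
  icoev_iev : forall M N : MM,
    fmap (ihomF M) (iev M N) ∘ icoev (ihomF M N) M = idm (ihomF M N)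
}.

Section InternalHom.
Context {k : fieldType} {C : rigcat k} {MM : modcat C} (H : inthom MM).
Implicit Types (X Y : C) (M N : MM).

(* The morphism corresponding to g under the adjunction. *)
Definition curry {X M N} (g : mor (X ▷ M) N) : mor X (H M N) :=
  fmap (H M) g ∘ icoev H X M.

Definition ihomc {M M'} (f : mor M M') N : mor (H M' N) (H M N) :=
  curry (iev H M' N ∘ (idm (H M' N) ▷h f)).

Definition icomp M1 M2 M3 : mor (H M2 M3 ⊗ H M1 M2) (H M1 M3) :=
  curry (iev H M2 M3 ∘ (idm (H M2 M3) ▷h iev H M1 M2) ∘
         eqm (esym (mactA (H M2 M3) (H M1 M2) M1))).

Definition iend_mul M : mor (H M M ⊗ H M M) (H M M) := icomp M M M.

Definition iend_unit M : mor 𝟙 (H M M) :=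
  fmap (H M) (eqm (mact1 M)) ∘ icoev H 𝟙 M.

Definition ihom_a X M N : mor (X ⊗ H M N) (H M (X ▷ N)) :=
  curry ((idm X ▷h iev H M N) ∘ eqm (esym (mactA X (H M N) M))).

Definition ihom_b M N X : mor (H M N ⊗ X) (H (rd X ▷ M) N) :=
  curry (iev H M N ∘
    (idm (H M N) ▷h
       (eqm (mact1 M) ∘ (rev X ▷h idm M) ∘ eqm (mactA X (rd X) M))) ∘
    eqm (esym (mactA (H M N) X (rd X ▷ M)))).

Lemma ihom_rd_ld X M N : H (rd (ld X) ▷ M) N = H (X ▷ M) N.
Proof. by rewrite rd_ld. Qed.

End InternalHom.

(* In [phi_module], and in [is_twisted_structure] below, the inverses of [ihom_a]
   and [ihom_b] are genuine ones: both are invertible since C is rigid. *)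
Record relserre {k : fieldType} {C : rigcat k} {MM : modcat C} (H : inthom MM) :=
RelSerre {
  serre :> functor MM MM;
  phi : forall M N : MM, mor (H N (serre M)) (ld (H M N));
  phi_iso : forall M N, is_iso (phi M N);
  phi_natl : forall (M M' N : MM) (f : mor M M'),
    phi M' N ∘ fmap (H N) (fmap serre f) = ldm (ihomc H f N) ∘ phi M N;
  phi_natr : forall (M N N' : MM) (g : mor N N'),
    phi M N ∘ ihomc H g (serre M) = ldm (fmap (H M) g) ∘ phi M N';
  phi_module : forall (M N : MM) (Y : C),
    phi M (rd Y ▷ N) ∘ ihom_b H N (serre M) Y =
    ldm (invm (ihom_a H (rd Y) M N)) ∘ eqm (ld_tens_rd (H M N) Y) ∘
      (phi M N ⊗h idm Y)
}.

Section RelativeSerre.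
Context {k : fieldType} {C : rigcat k} {MM : modcat C} {H : inthom MM}.
Variable S : relserre H.

(* The twisted C-module structure X^** ▷ S(M) -> S(X ▷ M) of S; it is uniquely
   determined by the last condition. *)
Definition is_twisted_structure
    (xi : forall (X : C) (M : MM), mor (ld (ld X) ▷ S M) (S (X ▷ M))) : Prop :=
  [/\ forall X M, is_iso (xi X M),
      forall (X X' : C) (M M' : MM) (f : mor X X') (g : mor M M'),
        fmap S (f ▷h g) ∘ xi X M = xi X' M' ∘ (ldm (ldm f) ▷h fmap S g)
    & forall (X : C) (M N : MM),
        phi S (X ▷ M) N ∘ fmap (H N) (xi X M) ∘ ihom_a H (ld (ld X)) N (S M) =
        ldm (invm (ihom_b H M N (ld X)) ∘ eqm (esym (ihom_rd_ld H X M N))) ∘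
          eqm (ld_tens_ld X (H M N)) ∘ (idm (ld (ld X)) ⊗h phi S M N)].

Definition itrace (M : MM) : mor (H M (S M)) 𝟙 :=
  eqm ld_unit ∘ ldm (iend_unit H M) ∘ phi S M M.

Definition is_module_pivotal (p : pivotal C)
    (xi : forall (X : C) (M : MM), mor (ld (ld X) ▷ S M) (S (X ▷ M)))
    (pt : forall M : MM, mor M (S M)) : Prop :=
  natural_iso (F := functor_id MM) (G := S) pt /\
  forall (X : C) (M : MM), pt (X ▷ M) = xi X M ∘ (p X ▷h pt M).

End RelativeSerre.

(* Main.v *)
From mathcomp Require Import all_boot all_algebra.
From mathcomp Require Import boolp classical_sets.
Require Import Defs.

Set Implicit Arguments.
Unset Strict Implicit.
Unset Printing Implicit Defensive.

Import GRing.Theory.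
Local Open Scope cat_scope.

(** Write A = [M,M] and t = t_M.  A morphism f : Z -> X^* is determined by the
    pairing ev_X (f ⊗ X) : Z ⊗ X -> 1, so both claims can be checked on pairings.
    The pairing of the Frobenius map of t is t μ.

    Nondegeneracy.  The pairing of phi_{M,N} is the trace of M composed with the
    composition [N,SM] ⊗ [M,N] -> [M,SM] ([ev_phi]).  Indeed that composition is
    the isomorphism b for the object [M,N], followed by precomposition with the mate
    M -> ^*[M,N] ▷ N of the evaluation ([icompE]); naturality of phi moves this mate
    across the trace, and compatibility of phi with the right action turns b into
    the dual of the inverse of a, so that only the dual of a right coevaluation,
    which is ev_[M,N], remains.  Taking N = M and composing with [M, pt_M], one sees
    that psi = phi_{M,M} [M, pt_M] has pairing t μ.  Hence psi is the Frobenius map,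
    and it is a composite of isomorphisms.

    Symmetry.  The Nakayama automorphism is the identity exactly when
    psi^* p_A = psi, which on pairings reads ev_{A^*} (p_A ⊗ psi) = t μ
    ([trace_mul_piv]).  Since μ = [M, iev] a, and pt is natural and
    compatible with the action, pt_M can be moved along iev : A ▷ M -> M to
    pt_{A ▷ M} = xi (p_A ▷ pt_M).  Naturality of phi in iev and the defining
    equation of xi then leave p_A ⊗ psi followed by the dual of the morphism
    1 -> A ⊗ A^* that b sends to the name of iev.  This morphism is coev_A
    ([ihomc_iev_unit]), and the dual of coev_A is ev_{A^*} ([ldm_coev]).

    The coherence isomorphisms [eqm] are dealt with by passing to arrows, that is,
    morphisms bundled with their source and target: there the strict associativity
    and unit laws are honest equalities, and every [eqm] becomes an identity. *)

(** * Arrows: morphisms up to equality of objects *)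

Reserved Notation "g • f" (at level 50, left associativity).
Reserved Notation "f ⊠ g" (at level 40, left associativity).
Reserved Notation "f ▶ h" (at level 41, right associativity).
Reserved Notation "⟦ f ⟧" (at level 0, format "⟦ f ⟧").

Section Arrows.
Context {k : fieldType} {C : lincat k}.

Record arrow := Arrow { dom : C; cod : C; hom : mor dom cod }.
Local Notation "⟦ f ⟧" := (Arrow f).

Definition id_arrow (X : C) : arrow := ⟦idm X⟧.

(** Composition of arrows is total: the composite of arrows that do not match is the
    zero morphism.  As composition is bilinear, zero is absorbing, and so
    associativity holds whether or not the arrows match, and can be rewritten with
    freely. *)
Definition comp_arrow (g f : arrow) : arrow :=
  @Arrow (dom f) (cod g)
    match pselect (cod f = dom g) with
    | left e => hom g ∘ eqm e ∘ hom f
    | right _ => 0%R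
    end.
Local Notation "g • f" := (comp_arrow g f).

Lemma eqm_id (X : C) (e : X = X) : eqm e = idm X.
Proof. by rewrite (Prop_irrelevance e erefl). Qed.

Lemma arrow_eq X Y X' Y' (f : mor X Y) (g : mor X' Y')
  (eX : X = X') (eY : Y = Y') :
  eqm eY ∘ f = g ∘ eqm eX -> ⟦f⟧ = ⟦g⟧.
Proof. by case: X' / eX g; case: Y' / eY => g /=; rewrite comp1m compm1 => ->. Qed.

Lemma arrow_inj X Y (f g : mor X Y) : ⟦f⟧ = ⟦g⟧ -> f = g.
Proof.
suff H (a b : arrow) : a = b ->
    exists (eX : dom a = dom b) (eY : cod a = cod b),
      eqm eY ∘ hom a = hom b ∘ eqm eX.
  by move/H => /= [eX] [eY]; rewrite !eqm_id comp1m compm1.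
by move=> ->; exists erefl, erefl; rewrite /= comp1m compm1.
Qed.

Lemma arrow_comp X Y Z (g : mor Y Z) (f : mor X Y) : ⟦g ∘ f⟧ = ⟦g⟧ • ⟦f⟧.
Proof.
rewrite /comp_arrow /=; case: pselect => //= e.
by rewrite eqm_id compm1.
Qed.

Lemma arrow_eqm (X Y : C) (e : X = Y) : ⟦eqm e⟧ = id_arrow X.
Proof. by case: Y / e. Qed.

Lemma arrow_split (f : arrow) : f = ⟦hom f⟧.
Proof. by case: f. Qed.

Lemma comp0m (X Y Z : C) (f : mor X Y) : (0%R : mor Y Z) ∘ f = 0%R.
Proof.
have /= := comp_linearl (Z := Z) f (-1)%R 0%R 0%R.
by rewrite scaler0 addr0 scaleN1r addNr.
Qed.

Lemma compm0 (X Y Z : C) (g : mor Y Z) : g ∘ (0%R : mor X Y) = 0%R.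
Proof.
have /= := comp_linearr (X := X) g (-1)%R 0%R 0%R.
by rewrite scaler0 addr0 scaleN1r addNr.
Qed.

Lemma comp_arrowA (h g f : arrow) : h • (g • f) = h • g • f.
Proof.
rewrite /comp_arrow /=; congr Arrow.
by case: pselect => ? /=; case: pselect => ? /=; rewrite ?compm0 ?comp0m ?compA.
Qed.

Lemma comp_idl X (f : arrow) : cod f = X -> id_arrow X • f = f.
Proof. by move=> <-; case: f => Y Z f /=; rewrite -arrow_comp comp1m. Qed.

Lemma comp_idr X (f : arrow) : dom f = X -> f • id_arrow X = f.
Proof. by move=> <-; case: f => Y Z f /=; rewrite -arrow_comp compm1. Qed.

End Arrows.
Arguments arrow {k} C.
Coercion id_arrow : ob >-> arrow.
Notation "⟦ f ⟧" := (Arrow f) : cat_scope.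
Notation "g • f" := (comp_arrow g f) : cat_scope.

(** * Tensor product and action on arrows *)

Section Tensor.
Context {k : fieldType} {C : moncat k}.
Implicit Types (X Y Z : C) (f g h : arrow C).

Definition tens_arrow f g : arrow C := ⟦hom f ⊗h hom g⟧.
Local Notation "f ⊠ g" := (tens_arrow f g).

(** The hypotheses cannot be dropped: f' • f may be zero because f and f' do not match
    while the sources and targets of the tensor products match by accident. *)
Lemma tens_comp f' f g' g : dom f' = cod f -> dom g' = cod g ->
  (f' • f) ⊠ (g' • g) = (f' ⊠ g') • (f ⊠ g).
Proof.
case: f' f g' g => [X' X'' f'] [X X1 f] [Y' Y'' g'] [Y Y1 g] /=.
move=> e1 e2; case: X1 / e1 f => f; case: Y1 / e2 g => g.
by rewrite -!arrow_comp /tens_arrow /= tensm_comp.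
Qed.

Lemma tens_arrowA f g h : f ⊠ (g ⊠ h) = f ⊠ g ⊠ h.
Proof. exact: arrow_eq (tensmA _ _ _). Qed.

Lemma tens_1f f : (𝟙 : C) ⊠ f = f.
Proof. by rewrite [RHS]arrow_split; apply: arrow_eq (tensm1f _). Qed.

Lemma tens_f1 f : f ⊠ (𝟙 : C) = f.
Proof. by rewrite [RHS]arrow_split; apply: arrow_eq (tensmf1 _). Qed.

Lemma tens_id X Y : X ⊠ Y = (X ⊗ Y : C) :> arrow C.
Proof. by rewrite /tens_arrow /= tensm_id. Qed.

Lemma arrow_tens X X' Y Y' (f : mor X X') (g : mor Y Y') : ⟦f ⊗h g⟧ = ⟦f⟧ ⊠ ⟦g⟧.
Proof. by []. Qed.

End Tensor.
Notation "f ⊠ g" := (tens_arrow f g) : cat_scope.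

Section Action.
Context {k : fieldType} {C : moncat k} {MM : modcat C}.
Implicit Types (X Y : C) (M N : MM) (f g : arrow C) (h : arrow MM).

Definition act_arrow f h : arrow MM := ⟦hom f ▷h hom h⟧.
Local Notation "f ▶ h" := (act_arrow f h).

Lemma act_comp f' f h' h : dom f' = cod f -> dom h' = cod h ->
  (f' • f) ▶ (h' • h) = (f' ▶ h') • (f ▶ h).
Proof.
case: f' f h' h => [X' X'' f'] [X X1 f] [Y' Y'' g'] [Y Y1 g] /=.
move=> e1 e2; case: X1 / e1 f => f; case: Y1 / e2 g => g.
by rewrite -!arrow_comp /act_arrow /= mactm_comp.
Qed.

Lemma act_arrowA f g h : f ▶ (g ▶ h) = (f ⊠ g) ▶ h.
Proof. exact: arrow_eq (mactmA _ _ _). Qed.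

Lemma act_1h h : (𝟙 : C) ▶ h = h.
Proof. by rewrite [RHS]arrow_split; apply: arrow_eq (mactm1 _). Qed.

Lemma act_id X M : X ▶ M = (X ▷ M : MM) :> arrow MM.
Proof. by rewrite /act_arrow /= mactm_id. Qed.

Lemma arrow_act X X' M M' (f : mor X X') (h : mor M M') : ⟦f ▷h h⟧ = ⟦f⟧ ▶ ⟦h⟧.
Proof. by []. Qed.

End Action.
Notation "f ▶ h" := (act_arrow f h) : cat_scope.

Lemma arrow_idm (k : fieldType) (C : lincat k) (X : C) : ⟦idm X⟧ = X.
Proof. by []. Qed.

(** Closes the matching conditions between sources and targets, using the
    equalities of objects that hold in the strict structures. *)
Ltac same_ob :=
  by rewrite /= ?(ld_tens, ld_unit, ld_rd, rd_ld, tensA, tens1X, tensX1,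
                  mactA, mact1).

Ltac drop_ids := rewrite ?comp_idl ?comp_idr; try same_ob.

(** The goal is matched syntactically, since rewriting with [arrow_comp] up to
    conversion would also unfold composites hidden in [ldm], [curry] and so on. *)
Ltac to_arrows :=
  repeat match goal with
  | |- context [Arrow (compm ?g ?f)] => rewrite (arrow_comp g f)
  | |- context [Arrow (eqm ?e)] => rewrite (arrow_eqm e)
  | |- context [Arrow (tensm ?f ?g)] => rewrite (arrow_tens f g)
  | |- context [Arrow (mactm ?f ?g)] => rewrite (arrow_act f g)
  | |- context [Arrow (idm ?X)] => rewrite (arrow_idm X)
  end.

Lemma arrow_congr (k : fieldType) (C : lincat k) (X Y : C) (f g : mor X Y) :
  f = g -> ⟦f⟧ = ⟦g⟧.
Proof. by move=> ->. Qed.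

(** A one-sided tensor product with an object (an identity arrow) distributes over
    composition, and tensor factors slide past each other.  In the names, [l] and [r]
    tell on which side the object stands, or which factor is applied last. *)
Section Whisker.
Context {k : fieldType} {C : moncat k} {MM : modcat C}.
Implicit Types (X Y : C) (M N : MM) (f g : arrow C) (h : arrow MM).

Lemma tens_compl X f g : dom g = cod f -> X ⊠ (g • f) = (X ⊠ g) • (X ⊠ f).
Proof. by move=> e; rewrite -tens_comp // comp_idr. Qed.

Lemma tens_compr X f g : dom g = cod f -> (g • f) ⊠ X = (g ⊠ X) • (f ⊠ X).
Proof. by move=> e; rewrite -tens_comp // comp_idr. Qed.

Lemma tens_lr f g X Y : dom f = X -> cod g = Y -> (f ⊠ Y) • (X ⊠ g) = f ⊠ g.
Proof. by move=> <- <-; rewrite -tens_comp // comp_idr // comp_idl. Qed.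

Lemma tens_rl f g X Y : cod f = X -> dom g = Y -> (X ⊠ g) • (f ⊠ Y) = f ⊠ g.
Proof. by move=> <- <-; rewrite -tens_comp // comp_idr // comp_idl. Qed.

Lemma act_compl X h h' : dom h' = cod h -> X ▶ (h' • h) = (X ▶ h') • (X ▶ h).
Proof. by move=> e; rewrite -act_comp // comp_idr. Qed.

Lemma act_compr M f g : dom g = cod f -> (g • f) ▶ M = (g ▶ M) • (f ▶ M).
Proof. by move=> e; rewrite -act_comp // comp_idr. Qed.

Lemma act_lr f h X M : dom f = X -> cod h = M -> (f ▶ M) • (X ▶ h) = f ▶ h.
Proof. by move=> <- <-; rewrite -act_comp // comp_idr // comp_idl. Qed.

Lemma act_rl f h X M : cod f = X -> dom h = M -> (X ▶ h) • (f ▶ M) = f ▶ h.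
Proof. by move=> <- <-; rewrite -act_comp // comp_idr // comp_idl. Qed.

End Whisker.

(** * Isomorphisms *)

Lemma invmP (k : fieldType) (C : lincat k) (X Y : C) (f : mor X Y) :
  is_iso f -> are_inverse f (invm f).
Proof.
by case=> g fg; apply: (@xgetPex _ _ [set g | are_inverse f g]); exists g.
Qed.

Lemma is_iso_comp (k : fieldType) (C : lincat k) (X Y Z : C)
  (g : mor Y Z) (f : mor X Y) : is_iso g -> is_iso f -> is_iso (g ∘ f).
Proof.
move=> [g' [gK Kg]] [f' [fK Kf]]; exists (f' ∘ g'); split.
  by rewrite compA -(compA f') gK compm1.
by rewrite compA -(compA g) Kf compm1.
Qed.

Lemma is_iso_fmap (k : fieldType) (C D : lincat k) (F : functor C D) (X Y : C)
  (f : mor X Y) : is_iso f -> is_iso (fmap F f).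
Proof.
move=> [g [gf fg]]; exists (fmap F g).
by split; rewrite -fmap_comp ?gf ?fg fmap_id.
Qed.

(** * Duals and pairings *)

Section Duals.
Context {k : fieldType} {C : rigcat k}.
Implicit Types (X Y Z : C) (f g : arrow C).

Lemma zigzag X : (X ⊠ ⟦ev X⟧) • (⟦coev X⟧ ⊠ X) = X.
Proof. have := arrow_congr (ld_zigzag X); to_arrows; drop_ids. Qed.

Lemma zagzig X : (⟦ev X⟧ ⊠ ld X) • (ld X ⊠ ⟦coev X⟧) = ld X.
Proof. have := arrow_congr (ld_zagzig X); to_arrows; drop_ids. Qed.

Lemma rzigzag X : (⟦rev X⟧ ⊠ X) • (X ⊠ ⟦rcoev X⟧) = X.
Proof. have := arrow_congr (rd_zigzag X); to_arrows; drop_ids. Qed.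

Lemma rzagzig X : (rd X ⊠ ⟦rev X⟧) • (⟦rcoev X⟧ ⊠ rd X) = rd X.
Proof. have := arrow_congr (rd_zagzig X); to_arrows; drop_ids. Qed.

(** Together with [pairingK]: f |-> ev_X (f ⊗ X) is a bijection from the morphisms
    Z -> X^* onto the morphisms Z ⊗ X -> 1.  Both [ldm] and [frobenius_map] are
    defined by the inverse bijection. *)
Lemma mateK Z X (c : arrow C) : dom c = Z ⊗ X -> cod c = 𝟙 ->
  ⟦ev X⟧ • (((c ⊠ ld X) • (Z ⊠ ⟦coev X⟧)) ⊠ X) = c.
Proof.
move=> dc cc; rewrite tens_compr; last by rewrite /= dc; same_ob.
rewrite comp_arrowA -!tens_arrowA tens_id -{1}(tens_1f ⟦ev X⟧) tens_rl //.
rewrite -(tens_lr dc (erefl (cod ⟦ev X⟧))) tens_f1 -tens_id -!tens_arrowA.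
by rewrite -comp_arrowA -tens_compl /= ?zigzag ?tens_id ?comp_idr //; same_ob.
Qed.

Lemma pairingK X Z (f : mor Z (ld X)) :
  ((⟦ev X⟧ • (⟦f⟧ ⊠ X)) ⊠ ld X) • (Z ⊠ ⟦coev X⟧) = ⟦f⟧.
Proof.
rewrite tens_compr // -!tens_arrowA tens_id -comp_arrowA.
rewrite tens_lr // -(tens_rl (f := ⟦f⟧) (g := ⟦coev X⟧) erefl erefl).
by rewrite tens_f1 comp_arrowA zagzig comp_idl.
Qed.

Lemma pairing_inj X Z (f g : mor Z (ld X)) :
  ev X ∘ (f ⊗h idm X) = ev X ∘ (g ⊗h idm X) -> f = g.
Proof.
move=> /(congr1 (fun h => ⟦h⟧)); to_arrows => e.
by apply: arrow_inj; rewrite -pairingK e pairingK.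
Qed.

Lemma arrow_ldm X Y (f : mor X Y) :
  ⟦ldm f⟧ = ((⟦ev Y⟧ • (ld Y ⊠ ⟦f⟧)) ⊠ ld X) • (ld Y ⊠ ⟦coev X⟧).
Proof.
rewrite /ldm; to_arrows; drop_ids; rewrite tens_compr //=.
by rewrite !tens_arrowA.
Qed.

Lemma arrow_ev_ldm X Y (f : mor X Y) :
  ⟦ev X⟧ • (⟦ldm f⟧ ⊠ X) = ⟦ev Y⟧ • (ld Y ⊠ ⟦f⟧).
Proof. by rewrite arrow_ldm mateK. Qed.

Lemma ev_ldm X Y (f : mor X Y) :
  ev X ∘ (ldm f ⊗h idm X) = ev Y ∘ (idm (ld Y) ⊗h f).
Proof. by apply: arrow_inj; to_arrows; rewrite arrow_ev_ldm. Qed.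

Lemma ldm_comp X Y Z (g : mor Y Z) (f : mor X Y) :
  ldm (g ∘ f) = ldm f ∘ ldm g.
Proof.
apply: pairing_inj; rewrite [LHS]ev_ldm; apply: arrow_inj; to_arrows.
rewrite tens_compr // tens_compl // !comp_arrowA arrow_ev_ldm -[RHS]comp_arrowA.
rewrite tens_rl // -(tens_lr (f := ⟦ldm g⟧) (g := ⟦f⟧) erefl erefl).
by rewrite comp_arrowA arrow_ev_ldm.
Qed.

(** The dual of a point of X is a functional on X^*: evaluation at that point. *)
Lemma arrow_ldm_point X (f : mor 𝟙 X) : ⟦ldm f⟧ = ⟦ev X⟧ • (ld X ⊠ ⟦f⟧).
Proof.
have := arrow_congr (ev_ldm f); rewrite ev_unit; to_arrows; rewrite tens_f1; drop_ids.
by rewrite tens_f1.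
Qed.

Lemma arrow_ev_tens X Y :
  ⟦ev (X ⊗ Y)⟧ = ⟦ev Y⟧ • (ld Y ⊠ ⟦ev X⟧ ⊠ Y).
Proof.
rewrite ev_tens; to_arrows; rewrite !tens_id; drop_ids.
by rewrite tens_arrowA.
Qed.

(** After [arrow_ldm_point] and [arrow_ev_tens] this is a triangle identity. *)
Lemma ldm_coev X : ⟦ldm (coev X)⟧ = ⟦ev (ld X)⟧.
Proof.
rewrite arrow_ldm_point arrow_ev_tens -comp_arrowA ld_tens -tens_id.
rewrite -!tens_arrowA -tens_compl; last by same_ob.
by rewrite zagzig tens_id comp_idr.
Qed.

Lemma ldm_rcoev X : ⟦ldm (rcoev X)⟧ = ⟦ev X⟧.
Proof.
have ev_rd : ⟦ev (rd X)⟧ = ⟦rev X⟧.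
  by rewrite rev_ev; to_arrows; rewrite tens_id; drop_ids.
rewrite arrow_ldm_point arrow_ev_tens ev_rd -comp_arrowA ld_tens ld_rd -tens_id.
rewrite -!tens_arrowA -tens_compl; last by same_ob.
by rewrite rzigzag tens_id comp_idr.
Qed.

Lemma rev_ld X : ⟦rev (ld X)⟧ = ⟦ev X⟧.
Proof. by rewrite rev_ev; to_arrows; rewrite rd_ld tens_id; drop_ids. Qed.

Lemma ev_frobenius_map (B : C) (mu : mor (B ⊗ B) B) (l : mor B 𝟙) :
  ev B ∘ (frobenius_map mu l ⊗h idm B) = l ∘ mu.
Proof.
apply: arrow_inj; rewrite /frobenius_map; to_arrows; drop_ids.
by rewrite mateK.
Qed.

End Duals.

(** * Internal Homs *)

Section InternalHom.
Context {k : fieldType} {C : rigcat k} {MM : modcat C} (H : inthom MM).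
Implicit Types (X Y : C) (M N P : MM).

Lemma iev_curry X M N (g : mor (X ▷ M) N) :
  ⟦iev H M N⟧ • (⟦curry H g⟧ ▶ M) = ⟦g⟧.
Proof.
rewrite -arrow_idm -arrow_act -arrow_comp /curry; congr Arrow.
rewrite -[idm M]comp1m mactm_comp compA iev_nat -compA iev_icoev.
exact: compm1.
Qed.

(** Together with [iev_curry] this is the adjunction: a morphism into [M,N] is
    determined by its composite with the evaluation.  The lemmas [iev_*] below compute
    that composite for each structure morphism; identities between such morphisms
    are checked on it. *)
Lemma uncurry_inj X M N (f g : mor X (H M N)) :
  ⟦iev H M N⟧ • (⟦f⟧ ▶ M) = ⟦iev H M N⟧ • (⟦g⟧ ▶ M) -> f = g.
Proof.
have curry_iev (h : mor X (H M N)) : curry H (iev H M N ∘ (h ▷h idm M)) = h.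
  by rewrite /curry fmap_comp -compA -icoev_nat compA icoev_iev comp1m.
rewrite -arrow_idm -!arrow_act -!arrow_comp => /arrow_inj e.
by rewrite -(curry_iev f) e curry_iev.
Qed.

(** The form of [uncurry_inj] that applies to composites of arrows. *)
Lemma uncurry_arrow_inj M N (f g : arrow C) : dom f = dom g ->
  cod f = H M N -> cod g = H M N ->
  ⟦iev H M N⟧ • (f ▶ M) = ⟦iev H M N⟧ • (g ▶ M) -> f = g.
Proof.
case: f g => [X Y f] [X' Z g] /= e; case: X' / e g => g eY.
case: _ / (esym eY) f => f eZ; case: _ / (esym eZ) g => g.
by move/uncurry_inj => ->.
Qed.

(** For arrows whose source is an action only up to equality of objects. *)
Lemma curry_ex X M N (g : arrow MM) : dom g = X ▷ M -> cod g = N ->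
  exists c : mor X (H M N), ⟦iev H M N⟧ • (⟦c⟧ ▶ M) = g.
Proof.
case: g => [Y Z g] /= eY; case: _ / (esym eY) g => g eZ; case: _ / eZ.
by exists (curry H g); apply: iev_curry.
Qed.

Lemma iev_fmap M N N' (g : mor N N') :
  ⟦iev H M N'⟧ • (⟦fmap (H M) g⟧ ▶ M) = ⟦g⟧ • ⟦iev H M N⟧.
Proof.
by rewrite -arrow_idm -arrow_act -!arrow_comp iev_nat.
Qed.

Lemma iev_icomp M N P :
  ⟦iev H M P⟧ • (⟦icomp H M N P⟧ ▶ M) = ⟦iev H N P⟧ • (H N P ▶ ⟦iev H M N⟧).
Proof. rewrite iev_curry; to_arrows; drop_ids. Qed.

Lemma iev_ihomc M M' N (f : mor M M') :
  ⟦iev H M N⟧ • (⟦ihomc H f N⟧ ▶ M) = ⟦iev H M' N⟧ • (H M' N ▶ ⟦f⟧).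
Proof. rewrite iev_curry; to_arrows; drop_ids. Qed.

Lemma iev_unit M : ⟦iev H M M⟧ • (⟦iend_unit H M⟧ ▶ M) = M.
Proof. rewrite iev_curry; to_arrows; drop_ids. Qed.

Lemma iev_ihom_a X M N :
  ⟦iev H M (X ▷ N)⟧ • (⟦ihom_a H X M N⟧ ▶ M) = X ▶ ⟦iev H M N⟧.
Proof. rewrite iev_curry; to_arrows; drop_ids. Qed.

Lemma iev_ihom_b M N X :
  ⟦iev H (rd X ▷ M) N⟧ • (⟦ihom_b H M N X⟧ ▶ (rd X ▷ M)) =
  ⟦iev H M N⟧ • (H M N ▶ ⟦rev X⟧ ▶ M).
Proof. rewrite iev_curry; to_arrows; drop_ids. Qed.

Lemma icomp_fmap M N P P' (g : mor P P') :
  fmap (H M) g ∘ icomp H M N P = icomp H M N P' ∘ (fmap (H N) g ⊗h idm (H M N)).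
Proof.
apply: uncurry_inj; to_arrows; rewrite !act_compr // !comp_arrowA iev_fmap.
rewrite -comp_arrowA !iev_icomp -act_arrowA act_id -[RHS]comp_arrowA act_rl //.
rewrite -(act_lr (X := H N P) (M := N) (f := ⟦fmap (H N) g⟧)) //.
by rewrite !comp_arrowA iev_fmap.
Qed.

Lemma ihom_a_nat X X' M N N' (f : mor X X') (g : mor N N') :
  fmap (H M) (f ▷h g) ∘ ihom_a H X M N = ihom_a H X' M N' ∘ (f ⊗h fmap (H M) g).
Proof.
apply: uncurry_inj; to_arrows; rewrite !act_compr // !comp_arrowA.
rewrite iev_fmap -comp_arrowA !iev_ihom_a; to_arrows.
rewrite -act_arrowA -!act_comp ?comp_idl ?comp_idr ?iev_fmap //; same_ob.
Qed.

Lemma iend_mulE M :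
  iend_mul H M = fmap (H M) (iev H M M) ∘ ihom_a H (H M M) M M.
Proof.
apply: uncurry_inj; to_arrows; rewrite !act_compr // !comp_arrowA.
by rewrite iev_fmap -comp_arrowA iev_ihom_a iev_icomp.
Qed.

Lemma iend_algebra M : is_algebra (iend_mul H M) (iend_unit H M).
Proof.
have iev_mul := iev_icomp M M M; have iev_one := iev_unit M.
split; apply: uncurry_inj; to_arrows; drop_ids; rewrite /iend_mul.
- rewrite !act_compr // !comp_arrowA iev_mul -!act_arrowA.
  rewrite -[in RHS]comp_arrowA -act_compl // iev_mul.
  rewrite act_id -[LHS]comp_arrowA act_rl //.
  rewrite -(act_lr (X := H M M ⊗ H M M) (M := M) (f := ⟦icomp H M M M⟧)) //.
  by rewrite comp_arrowA iev_mul act_compl // comp_arrowA act_arrowA tens_id.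
- rewrite act_compr ?comp_arrowA ?iev_mul -?comp_arrowA; last by same_ob.
  rewrite -act_arrowA act_id act_rl // -(act_lr (X := 𝟙) (M := M)) //.
  by rewrite comp_arrowA iev_one act_1h comp_idr ?comp_idl.
- rewrite act_compr ?comp_arrowA ?iev_mul -?comp_arrowA; last by same_ob.
  by rewrite -act_arrowA -act_compl // iev_one.
Qed.

(** Rigidity makes a invertible.  With Q = [M, X ▷ N], the inverse is
    (X ⊗ c)(coev_X ⊗ Q) : Q -> X ⊗ X^* ⊗ Q -> X ⊗ [M,N], where c : X^* ⊗ Q -> [M,N]
    corresponds to evaluating Q on M and then contracting X^* with X. *)
Lemma ihom_a_iso X M N : is_iso (ihom_a H X M N).
Proof.
pose Q := H M (X ▷ N); have iev_a := iev_ihom_a X M N.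
have [||c iev_c] := @curry_ex (ld X ⊗ Q) M N
  ((⟦ev X⟧ ▶ N) • (ld X ▶ ⟦iev H M (X ▷ N)⟧)); [same_ob..|].
have ca : ⟦c⟧ • (ld X ⊠ ⟦ihom_a H X M N⟧) = ⟦ev X⟧ ⊠ H M N.
  apply: (@uncurry_arrow_inj M N) => //=; [same_ob..|].
  rewrite act_compr // comp_arrowA iev_c -comp_arrowA -!act_arrowA.
  rewrite -act_compl // iev_a act_arrowA tens_id act_lr ?act_id; [|same_ob..].
  rewrite -(act_rl (X := 𝟙) (M := H M N ▷ M)) // act_1h //.
exists ((idm X ⊗h c) ∘ eqm (esym (tensA X (ld X) Q)) ∘
  (coev X ⊗h idm Q) ∘ eqm (esym (tens1X Q))).
split; apply: arrow_inj; to_arrows; drop_ids.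
- rewrite -(tens_1f ⟦ihom_a H X M N⟧) -comp_arrowA tens_lr //.
  rewrite -(tens_rl (f := ⟦coev X⟧) (X := X ⊗ ld X) (Y := X ⊗ H M N)) //.
  rewrite -!tens_id -tens_arrowA comp_arrowA -tens_compl /= ?ca; last by same_ob.
  by rewrite !tens_arrowA -tens_compr /= ?zigzag //; same_ob.
- apply: (@uncurry_arrow_inj M (X ▷ N)) => //=; [same_ob..|].
  rewrite act_compr ?comp_arrowA ?iev_a -?comp_arrowA; last by same_ob.
  rewrite act_compr; last by same_ob.
  rewrite -act_arrowA comp_arrowA -act_compl // iev_c act_compl; last by same_ob.
  rewrite -comp_arrowA [X ▶ (ld X ▶ _)]act_arrowA tens_id.
  rewrite -(act_arrowA ⟦coev X⟧) act_id act_rl //.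
  rewrite -(act_lr (f := ⟦coev X⟧) (X := 𝟙) (M := X ▷ N)) // act_1h.
  rewrite -act_id !act_arrowA.
  rewrite comp_arrowA -act_compr /= ?zigzag ?act_id ?comp_idl ?comp_idr //.
  all: same_ob.
Qed.

(** With Q = [^*X ▷ M, N], the inverse of b is
    (d ⊗ X)(Q ⊗ rcoev_X) : Q -> Q ⊗ ^*X ⊗ X -> [M,N] ⊗ X, where d : Q ⊗ ^*X -> [M,N]
    corresponds to the evaluation of Q on ^*X ▷ M. *)
Lemma ihom_b_iso M N X : is_iso (ihom_b H M N X).
Proof.
pose Q := H (rd X ▷ M) N; have iev_b := iev_ihom_b M N X.
have [||d iev_d] := @curry_ex (Q ⊗ rd X) M N ⟦iev H (rd X ▷ M) N⟧; [same_ob..|].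
have db : ⟦d⟧ • (⟦ihom_b H M N X⟧ ⊠ rd X) = H M N ⊠ ⟦rev X⟧.
  apply: (@uncurry_arrow_inj M N) => //=; [same_ob..|].
  by rewrite act_compr // comp_arrowA iev_d -!act_arrowA act_id iev_b.
exists ((d ⊗h idm X) ∘ eqm (tensA Q (rd X) X) ∘
  (idm Q ⊗h rcoev X) ∘ eqm (esym (tensX1 Q))).
split; apply: arrow_inj; to_arrows; drop_ids.
- rewrite -(tens_f1 ⟦ihom_b H M N X⟧) -comp_arrowA tens_rl //.
  rewrite -(tens_lr (f := ⟦ihom_b H M N X⟧) (X := H M N ⊗ X) (Y := rd X ⊗ X)) //.
  rewrite -!tens_id tens_arrowA comp_arrowA -tens_compr /= ?db; last by same_ob.
  by rewrite -!tens_arrowA -tens_compl /= ?rzigzag //; same_ob.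
- apply: (@uncurry_arrow_inj (rd X ▷ M) N) => //=; [same_ob..|].
  rewrite act_compr ?comp_arrowA ?iev_b -?comp_arrowA; last by same_ob.
  rewrite act_compr; last by same_ob.
  rewrite comp_arrowA -(act_arrowA ⟦d⟧) act_id -comp_arrowA.
  rewrite [in X in _ • X]comp_arrowA.
  rewrite act_rl; [|same_ob..].
  rewrite -(act_lr (f := ⟦d⟧) (X := Q ⊗ rd X) (M := M)) //; last by same_ob.
  rewrite !comp_arrowA iev_d -!comp_arrowA -tens_id -!act_id -!act_arrowA.
  rewrite -act_compl; last by same_ob.
  rewrite !(act_arrowA _ _ (id_arrow M)) -act_compr; last by same_ob.
  by rewrite rzagzig act_arrowA tens_id.
Qed.

End InternalHom.

(** * The evaluation of an internal Hom and duality *)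

Section EvaluationMate.
Context {k : fieldType} {C : rigcat k} {MM : modcat C} (H : inthom MM).
Context (M N : MM).
Let Y := H M N.

(** The mate of iev : Y ▷ M -> N under the duality of Y and ^*Y. *)
Definition iev_mate : mor M (rd Y ▷ N) :=
  (idm (rd Y) ▷h iev H M N) ∘ eqm (esym (mactA (rd Y) Y M)) ∘
  (rcoev Y ▷h idm M) ∘ eqm (esym (mact1 M)).

Lemma arrow_iev_mate : ⟦iev_mate⟧ = (rd Y ▶ ⟦iev H M N⟧) • (⟦rcoev Y⟧ ▶ M).
Proof. by rewrite /iev_mate; to_arrows; drop_ids. Qed.

(** Composing with [M,N] amounts to pulling back along the mate, since contracting
    the mate with [M,N] gives back the evaluation. *)
Lemma icompE P : icomp H M N P = ihomc H iev_mate P ∘ ihom_b H N P Y.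
Proof.
have rev_iev_mate : (⟦rev Y⟧ ▶ N) • (Y ▶ ⟦iev_mate⟧) = ⟦iev H M N⟧.
  rewrite arrow_iev_mate act_compl; last by same_ob.
  rewrite comp_arrowA (act_arrowA Y) tens_id act_lr; [|same_ob..].
  rewrite -(act_rl (f := ⟦rev Y⟧) (X := 𝟙) (M := Y ▷ M)) // act_1h -comp_arrowA.
  rewrite -(act_id Y M) !act_arrowA -act_compr ?rzigzag; last by same_ob.
  by rewrite act_id comp_idr.
apply: uncurry_inj; to_arrows; rewrite act_compr // comp_arrowA iev_ihomc iev_icomp.
rewrite -comp_arrowA act_rl //.
rewrite -(act_lr (f := ⟦ihom_b H N P Y⟧) (X := H N P ⊗ Y) (M := rd Y ▷ N)) //.
rewrite comp_arrowA iev_ihom_b -comp_arrowA -tens_id -act_arrowA.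
by rewrite -act_compl ?rev_iev_mate //; same_ob.
Qed.

(** The two sides are the name 1 -> [M, ^*Y ▷ N] of the mate. *)
Lemma fmap_iev_mate :
  fmap (H M) iev_mate ∘ iend_unit H M = ihom_a H (rd Y) M N ∘ rcoev Y.
Proof.
apply: uncurry_inj; to_arrows; rewrite !act_compr // !comp_arrowA.
rewrite iev_fmap -comp_arrowA iev_unit iev_ihom_a comp_idr //.
exact: arrow_iev_mate.
Qed.

(** The two sides are the name 1 -> [Y ▷ M, N] of the evaluation. *)
Lemma ihomc_iev_unit :
  ihomc H (iev H M N) N ∘ iend_unit H N =
  eqm (ihom_rd_ld H Y M N) ∘ ihom_b H M N (ld Y) ∘ coev Y.
Proof.
(* Only whole arrows are rewritten along ^*(Y^* ) = Y: inside the type of b the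
   object occurs dependently. *)
have iev_b := iev_ihom_b H M N (ld Y); rewrite rev_ld in iev_b.
have rd_ldM : id_arrow (rd (ld Y) ▷ M) = Y ▷ M by rewrite rd_ld.
have iev_rd_ld : ⟦iev H (rd (ld Y) ▷ M) N⟧ = ⟦iev H (Y ▷ M) N⟧.
  by rewrite rd_ld.
rewrite rd_ldM iev_rd_ld in iev_b.
apply: uncurry_inj; to_arrows; drop_ids.
rewrite !act_compr; [|same_ob..].
rewrite !comp_arrowA iev_ihomc iev_b -!comp_arrowA act_rl //.
rewrite -(act_lr (f := ⟦iend_unit H N⟧) (X := 𝟙) (M := N)) //.
rewrite act_1h comp_arrowA iev_unit comp_idl //.
rewrite -(act_id Y M) !act_arrowA -act_compr; last by same_ob.
by rewrite zigzag act_id comp_idr.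
Qed.

End EvaluationMate.

(** * The trace and the pairing of the Serre isomorphism *)

Section Serre.
Context {k : fieldType} {C : rigcat k} {MM : modcat C} {H : inthom MM}.
Context (S : relserre H).

(** This recovers phi from the trace alone: under phi, internal Homs are paired by
    composing and taking the trace. *)
Lemma ev_phi (M N : MM) :
  ev (H M N) ∘ (phi S M N ⊗h idm (H M N)) = itrace S M ∘ icomp H M N (S M).
Proof.
set Y := H M N.
have [aK _] := invmP (ihom_a_iso H (rd Y) M N).
have natr : ⟦phi S M M⟧ • ⟦ihomc H (iev_mate H M N) (S M)⟧ =
    ⟦ldm (fmap (H M) (iev_mate H M N))⟧ • ⟦phi S M (rd Y ▷ N)⟧.
  by rewrite -!arrow_comp phi_natr.
have modl : ⟦phi S M (rd Y ▷ N)⟧ • ⟦ihom_b H N (S M) Y⟧ =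
    ⟦ldm (invm (ihom_a H (rd Y) M N))⟧ • (⟦phi S M N⟧ ⊠ Y).
  by have := arrow_congr (phi_module S M N Y); to_arrows; drop_ids.
(* The name of the mate is a rcoev_Y, so the duals of a and of its inverse cancel. *)
have dual_a : ⟦ldm (iend_unit H M)⟧ • ⟦ldm (fmap (H M) (iev_mate H M N))⟧ •
    ⟦ldm (invm (ihom_a H (rd Y) M N))⟧ = ⟦ev Y⟧.
  by rewrite -!arrow_comp -!ldm_comp fmap_iev_mate compA aK comp1m ldm_rcoev.
apply: arrow_inj; rewrite icompE /itrace; to_arrows; drop_ids.
rewrite comp_arrowA -(comp_arrowA _ _ ⟦ihomc _ _ _⟧) natr comp_arrowA.
by rewrite -(comp_arrowA _ _ ⟦ihom_b _ _ _ _⟧) modl comp_arrowA dual_a.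
Qed.

(** * Symmetry from a pivotal structure *)

Context (p : pivotal C) (pt : forall M : MM, mor M (S M)).
Context (xi : forall X M, mor (ld (ld X) ▷ S M) (S (X ▷ M))).
Context (xi_twisted : is_twisted_structure xi).
Context (pt_pivotal : is_module_pivotal p xi pt).
Context (M : MM).

Let A := H M M.
Let lam : mor A 𝟙 := itrace S M ∘ fmap (H M) (pt M).
Let psi : mor A (ld A) := phi S M M ∘ fmap (H M) (pt M).

Lemma ev_psi : ev A ∘ (psi ⊗h idm A) = lam ∘ iend_mul H M.
Proof.
rewrite /lam -compA icomp_fmap compA -ev_phi -compA -tensm_comp.
by rewrite comp1m.
Qed.

(** The pairing on the right is that of psi^* p_A, so this is the symmetry of t. *)
Lemma trace_mul_piv : lam ∘ iend_mul H M = ev (ld A) ∘ (p A ⊗h psi).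
Proof.
have [[pt_nat _] pt_act] := pt_pivotal; have [_ _ xi_phi] := xi_twisted.
have [bK _] := invmP (ihom_b_iso H M M (ld A)).
have natl : ⟦phi S M M⟧ • ⟦fmap (H M) (fmap S (iev H M M))⟧ =
    ⟦ldm (ihomc H (iev H M M) M)⟧ • ⟦phi S (A ▷ M) M⟧.
  by rewrite -!arrow_comp phi_natl.
have modl : ⟦phi S (A ▷ M) M⟧ • ⟦fmap (H M) (xi A M)⟧ •
      ⟦ihom_a H (ld (ld A)) M (S M)⟧ =
    ⟦ldm (invm (ihom_b H M M (ld A)) ∘ eqm (esym (ihom_rd_ld H A M M)))⟧ •
      (ld (ld A) ⊠ ⟦phi S M M⟧).
  by have := arrow_congr (xi_phi A M M); to_arrows; drop_ids.
(* The name of iev is b coev_A, so the duals of b and of its inverse cancel and the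
   dual of coev_A is left. *)
have dual_b : ⟦ldm (iend_unit H M)⟧ • ⟦ldm (ihomc H (iev H M M) M)⟧ •
    ⟦ldm (invm (ihom_b H M M (ld A)) ∘ eqm (esym (ihom_rd_ld H A M M)))⟧ =
    ⟦ev (ld A)⟧.
  rewrite -!arrow_comp -!ldm_comp ihomc_iev_unit -ldm_coev; congr ⟦ldm _⟧.
  transitivity (invm (ihom_b H M M (ld A)) ∘ ihom_b H M M (ld A) ∘ coev A).
    by apply: arrow_inj; to_arrows; rewrite !comp_arrowA; drop_ids.
  by rewrite bK comp1m.
(* Sliding pt_M along iev turns it into pt_{A ▷ M}, where pivotality applies. *)
have pt_iev : fmap (H M) (pt M) ∘ iend_mul H M =
    fmap (H M) (fmap S (iev H M M)) ∘ fmap (H M) (xi A M) ∘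
    ihom_a H (ld (ld A)) M (S M) ∘ (p A ⊗h fmap (H M) (pt M)).
  rewrite iend_mulE compA -fmap_comp -pt_nat /= pt_act.
  by rewrite -[RHS]compA -ihom_a_nat !fmap_comp !compA.
have := arrow_congr pt_iev; to_arrows => {}pt_iev.
apply: arrow_inj; rewrite /lam /itrace; to_arrows; drop_ids.
rewrite -comp_arrowA pt_iev !comp_arrowA.
rewrite -(comp_arrowA _ _ ⟦fmap _ (fmap _ _)⟧) natl.
rewrite comp_arrowA -(comp_arrowA _ _ ⟦fmap _ (xi _ _)⟧).
rewrite -(comp_arrowA _ (_ • _)) modl.
rewrite comp_arrowA dual_b -comp_arrowA -tens_comp // comp_idl //.
by rewrite /psi arrow_comp.
Qed.

Lemma iend_frobenius_map : frobenius_map (iend_mul H M) lam = psi.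
Proof. by apply: pairing_inj; rewrite ev_psi ev_frobenius_map. Qed.

Lemma iend_symmetric_frobenius :
  is_symmetric_frobenius_algebra (iend_mul H M) (iend_unit H M) lam p.
Proof.
have psi_is_iso : is_iso psi.
  have [[_ pt_iso] _] := pt_pivotal.
  by apply: is_iso_comp; [apply: phi_iso | apply/is_iso_fmap/pt_iso].
split; first by split; [apply: iend_algebra | rewrite iend_frobenius_map].
rewrite /nakayama iend_frobenius_map -compA.
have [psiK _] := invmP psi_is_iso.
suff -> : ldm psi ∘ p A = psi by [].
apply: pairing_inj; rewrite ev_psi trace_mul_piv; apply: arrow_inj; to_arrows.
by rewrite tens_compr // comp_arrowA arrow_ev_ldm -comp_arrowA tens_rl.
Qed.

End Serre.

Theorem theorem3p15
  (k : fieldType) (C : fintenscat k) (p : pivotal C)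
  (MM : finmodcat C) (exactMM : exact_modcat MM)
  (H : inthom MM) (S : relserre H)
  (xi : forall (X : C) (M : MM), mor (ld (ld X) ▷ S M) (S (X ▷ M)))
  (xi_twisted : is_twisted_structure xi)
  (pt : forall M : MM, mor M (S M))
  (pt_pivotal : is_module_pivotal p xi pt)
  (M : MM) :
  is_symmetric_frobenius_algebra
    (iend_mul H M) (iend_unit H M)
    (itrace S M ∘ fmap (H M) (pt M)) p.
Proof. exact: iend_symmetric_frobenius xi_twisted pt_pivotal M. Qed.
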